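(* Let $\theta>0$ be fixed and let $p>\max\{1,1/\theta\}$. There is a constant $C=C(\theta,p)>0$, depending only on $\theta$ and $p$, such that for every integer $n\ge1$ and all complex numbers $\hat f(1),\dots,\hat f(n)$ with $|\hat f(j)|\le 1$ for $1\le j\le n$, the mean value $M_n(f)$ with respect to the Ewens measure on the symmetric group $S_n$ of the multiplicative function $f:S_n\to\mathbb{C}$ determined by these numbers satisfies $$ \left|M_n(f)-\exp\left\{\theta\sum_{k=1}^{n}\frac{\hat f(k)-1}{k}\right\}\right|\le C\,\mu_n(p), \qquad \mu_n(p)=\left(\frac1n\sum_{k=1}^n|\hat f(k)-1|^p\right)^{1/p}. $$
   Context: Each $\sigma\in S_n$ decomposes, uniquely up to order, into a product of independent (disjoint) cycles $\sigma=\kappa_1\kappa_2\cdots\kappa_\omega$ (fixed points count as cycles of length $1$). Let $m_k(\sigma)$ be the number of cycles of length $k$ in this decomposition, so $\sum_{k=1}^n k\,m_k(\sigma)=n$. A function $f:S_n\to\mathbb{C}$ is multiplicative if $f(\sigma)=f(\kappa_1)\cdots f(\kappa_\omega)$, and it is assumed that the value of $f$ on a cycle depends only on its length: $f(\kappa)=\hat f(|\kappa|)$, where $|\kappa|$ is the length of $\kappa$. Thus, for given complex numbers $\hat f(1),\dots,\hat f(n)$, $$f(\sigma)=\hat f(1)^{m_1(\sigma)}\hat f(2)^{m_2(\sigma)}\cdots\hat f(n)^{m_n(\sigma)}$$ (with $0^0=1$). The Ewens measure on $S_n$ with parameter $\theta$ is $$\nu_{n,\theta}(\sigma)=\frac{\theta^{k(\sigma)}}{\theta(\theta+1)\cdots(\theta+n-1)},\qquad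 k(\sigma)=m_1(\sigma)+\dots+m_n(\sigma),$$ and the mean value is $M_n(f)=\sum_{\sigma\in S_n}f(\sigma)\,\nu_{n,\theta}(\sigma)$. *)

(* Defs.v *)
From HB Require Import structures.
From mathcomp Require Import all_boot all_order all_algebra all_fingroup.
From mathcomp Require Import all_classical all_reals all_analysis.
From mathcomp Require Import complex.
Set Implicit Arguments.
Unset Strict Implicit.
Unset Printing Implicit Defensive.
Import Order.TTheory GRing.Theory Num.Theory.
Local Open Scope ring_scope.
Local Open Scope complex_scope.

(* [porbits s] is the set of all cycles of s; each fixed point contributes
   a singleton. *)
Definition cycle_mult (n : nat) (s : 'S_n) (k : nat) : nat :=
  #|[set c in porbits s | #|c| == k]|.

Definition cycle_count (n : nat) (s : 'S_n) : nat :=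
  (\sum_(1 <= k < n.+1) cycle_mult s k)%N.

(* Only the values fhat 1, ..., fhat n are used; x ^+ 0 = 1 also for x = 0. *)
Definition mulfun (R : realType) (n : nat) (fhat : nat -> R[i]) (s : 'S_n)
    : R[i] :=
  \prod_(1 <= k < n.+1) fhat k ^+ cycle_mult s k.

Definition ewens (R : realType) (n : nat) (theta : R) (s : 'S_n) : R :=
  theta ^+ cycle_count s / \prod_(0 <= i < n) (theta + i%:R).

Definition mean_value (R : realType) (n : nat) (theta : R) (f : 'S_n -> R[i])
    : R[i] :=
  \sum_(s : 'S_n) f s * (ewens theta s)%:C.

Definition cexp (R : realType) (z : R[i]) : R[i] :=
  (expR (complex.Re z))%:C * (cos (complex.Im z) +i* sin (complex.Im z)).

(* The modulus as an element of R; the library's [`|z|] lives in R[i]. *)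
Definition cmod (R : realType) (z : R[i]) : R := ComplexField.Normc.normc z.

Definition mu (R : realType) (n : nat) (p : R) (fhat : nat -> R[i]) : R :=
  (n%:R^-1 * \sum_(1 <= k < n.+1) cmod (fhat k - 1) `^ p) `^ p^-1.

(* Main.v *)
(* With [f k = 1] for [k > n], write [d m] for the coefficients of
   [(1 - X)^-theta] and [N m = d m * M_m f] for those of
   [exp(theta * \sum_k f k X^k / k)], so that [m N_m = theta \sum_k f k N_(m-k)].
   Replacing [f k] by [1] in this recurrence turns [M_m] into the weighted average
   [s_m = (\sum_(j<m) N j) / (\sum_(j<m) d j)] of its predecessors, and both
   [|M_m - s_m|] and [m |s_(m+1) - s_m|] are at most a constant times
   [\sum_k |f k - 1| d_(m-k) / (m d_m)].  By Hoelder and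
   [\sum_(j<m) d_j^q <= c m d_m^q] (this needs [p theta > 1]) that quantity is
   [O((\sum_k |f k - 1|^p / m)^(1/p))], hence [|M_n - M_m| = O(mu_n(p))] uniformly
   in [m >= n].  Finally [M_m] tends to [exp(theta \sum_(k<=n) (f k - 1) / k)]
   as [m] goes to infinity.  Probabilistically, this compares cycle counts with
   their Poisson limits along the Feller coupling. *)

Require Import Defs.
From mathcomp Require Import all_boot all_order all_algebra all_fingroup.
From mathcomp Require Import all_classical all_reals all_analysis.
From mathcomp Require Import complex.
From mathcomp Require Import zify ring lra.
Import Order.TTheory GRing.Theory Num.Theory.
Import numFieldNormedType.Exports.
Local Open Scope ring_scope.
Local Open Scope complex_scope.

(** * Permutations weighted by their cycle lengths *)

(** The iterates of [s] from [z] never meet [x] or [y], so the transposition acts trivially along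
    them. *)
Lemma porbit_mul_tperm (T : finType) (s : {perm T}) (x y z : T) :
  x \notin porbit s z -> y \notin porbit s z ->
  porbit (s * tperm x y)%g z = porbit s z.
Proof.
move=> xz yz.
have E i : ((s * tperm x y) ^+ i)%g z = (s ^+ i)%g z.
  elim: i => [|i IH]; first by rewrite !expg0.
  rewrite !expgSr !permM IH -[s _]permM -expgSr tpermD //.
    by apply: contraNneq xz => ->; exact: mem_porbit.
  by apply: contraNneq yz => ->; exact: mem_porbit.
apply/finset.setP => u; apply/porbitP/porbitP => -[i ->]; exists i; by rewrite E.
Qed.

Lemma porbit_fixed (T : finType) (s : {perm T}) (x : T) :
  s x = x -> porbit s x = [set x].
Proof.
move=> sx; apply/finset.setP => u; rewrite inE; apply/porbitP/eqP => [[i ->]|->].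
  elim: i => [|i IH]; first by rewrite expg0 perm1.
  by rewrite expgSr permM IH.
by exists 0%N; rewrite expg0 perm1.
Qed.

(** A point of the old cycle missed by the new one would have an orbit avoiding both [x] and [y],
    which undoing the transposition leaves unchanged. So [x] is spliced in just before [y] and
    nothing is lost. *)
Lemma porbit_insert (T : finType) (s : {perm T}) (x y : T) :
  s x = x -> y != x -> porbit (s * tperm x y)%g x = x |: porbit s y.
Proof.
move=> sx yx; set r := (s * tperm x y)%g.
have rx : r x = y by rewrite permM sx tpermL.
have xy : x \notin porbit s y.
  by rewrite porbit_sym porbit_fixed // inE.
have yr : y \in porbit r x by rewrite -rx -{1}[r]expg1 mem_porbit.
have sE : s = (r * tperm x y)%g by rewrite /r -mulgA tperm2 mulg1.
apply/finset.setP => z; rewrite !inE.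
apply/idP/idP => [zr|/predU1P[->|zs]]; last 2 first.
- exact: porbit_id.
- apply/negPn/negP => zr.
  have zx : x \notin porbit r z by rewrite porbit_sym.
  have zy : y \notin porbit r z.
    by move: yr zr; rewrite -!eq_porbit_mem eq_sym => /eqP ->; rewrite eq_sym.
  have E : porbit s z = porbit r z by rewrite sE porbit_mul_tperm.
  by rewrite porbit_sym E (negPf zy) in zs.
case: eqP => //= /eqP zx; apply/negPn/negP => zs.
have E : porbit r z = porbit s z.
  apply: porbit_mul_tperm; rewrite porbit_sym //.
  by rewrite porbit_fixed // inE.
have : x \in porbit s z by rewrite -E porbit_sym.
by rewrite porbit_sym porbit_fixed // inE (negPf zx).
Qed.

Section PermSum.
Context {T : finType} {K : comNzRingType}.
Implicit Types (w g : nat -> K) (A : {set T}) (s : {perm T}) (x y : T).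

(** The restriction to cycles inside [A] discards the fixed points outside [A], so that permutations
    of subsets all live in [{perm T}]. *)
Definition cycle_weight w A s : K :=
  \prod_(c in porbits s | c \subset A) w #|c|.

Definition perm_sum w A : K := \sum_(s | perm_on A s) cycle_weight w A s.

(** The cycle through the root [x] is not contained in [A :\ x]; it gets its own weight [g], free to
    be shifted while that cycle is shortened point by point. *)
Definition rooted_sum w A x g : K :=
  \sum_(s | perm_on A s) g #|porbit s x| * cycle_weight w (A :\ x) s.

Lemma porbit_sub A s x : perm_on A s -> x \in A -> porbit s x \subset A.
Proof.
move=> sA xA; apply/fintype.subsetP => z /porbitP[i ->].
elim: i => [|i IH]; first by rewrite expg0 perm1.
by rewrite expgSr permM perm_closed.
Qed.

Lemma perm_sum_rooted w A x : x \in A -> perm_sum w A = rooted_sum w A x w.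
Proof.
move=> xA; apply: eq_bigr => s sA; rewrite /cycle_weight.
rewrite (bigD1 (porbit s x)) /=; last by rewrite imset_f //= porbit_sub.
congr (_ * _); apply: eq_bigl => c; rewrite -andbA; apply/andb_id2l.
case/imsetP => z _ ->; rewrite finset.subsetD1; congr (_ && _).
by rewrite eq_porbit_mem porbit_sym.
Qed.

(** The permutations are sorted by the image [y] of [x]; multiplying by [tperm x y] makes [x] a
    fixed point and is its own inverse. *)
Lemma sum_perm_on A x (F : {perm T} -> K) : x \in A ->
  \sum_(s | perm_on A s) F s =
  \sum_(y in A) \sum_(s | perm_on (A :\ x) s) F (s * tperm x y)%g.
Proof.
move=> xA; rewrite (partition_big (fun s : {perm T} => s x) (mem A)) /=; last first.
  by move=> s sA; rewrite perm_closed.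
apply: eq_bigr => y yA.
have txy : perm_on A (tperm x y).
  apply: (fintype.subset_trans (tperm_on x y)).
  by apply/fintype.subsetP => z; rewrite !inE => /orP[]/eqP ->.
rewrite (reindex_inj (mulIg (tperm x y))) /=; apply: eq_bigl => s.
rewrite permM -[X in _ == X](tpermL x y) (inj_eq perm_inj).
apply/andP/idP => [[sA /eqP sx]|sA].
  have sA' : perm_on A s.
    by rewrite -[s]mulg1 -(tperm2 x y) mulgA; apply: perm_onM.
  apply/fintype.subsetP => z; rewrite !inE => sz.
  rewrite (contraNneq _ sz) /=; last first.
    by move=> ->; rewrite sx.
  by apply: (fintype.subsetP sA').
split; last by rewrite (out_perm sA) // !inE eqxx.
apply: perm_onM => //.
by apply: (fintype.subset_trans sA); apply: finset.subsetDl.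
Qed.

(* Multiplying [s] by [tperm x (s x)] takes [x] out of its cycle, which leaves a
   permutation of [A :\ x] rooted at the former image of [x]. *)
Lemma rooted_sum_rec w A x g : x \in A ->
  rooted_sum w A x g = g 1%N * perm_sum w (A :\ x)
    + \sum_(y in A :\ x) rooted_sum w (A :\ x) y (g \o succn).
Proof.
move=> xA; rewrite /rooted_sum (sum_perm_on A x) // (bigD1 x) //=; congr (_ + _).
  rewrite mulr_sumr; apply: eq_bigr => s sA.
  rewrite tperm1 mulg1 porbit_fixed ?cards1 //.
  by rewrite (out_perm sA) // !inE eqxx.
rewrite [RHS](eq_bigl [pred y in A | y != x]) => [|y]; last by rewrite !inE andbC.
apply: eq_bigr => y /andP[yA yx]; apply: eq_bigr => s sA.
have sx : s x = x by rewrite (out_perm sA) // !inE eqxx.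
have xy : x \notin porbit s y by rewrite porbit_sym porbit_fixed // inE.
rewrite porbit_insert // cardsU1 xy add1n /=; congr (_ * _).
apply: eq_bigl => c; apply/andP/andP => -[/imsetP[z _ ->]] /=.
  rewrite finset.subsetD1 => /andP[zA xz].
  have zx : z != x by apply: contraNneq xz => ->; rewrite porbit_id.
  have zy : z \notin porbit s y.
    move: xz; rewrite porbit_sym porbit_insert // !inE negb_or.
    by case/andP.
  have E : porbit (s * tperm x y)%g z = porbit s z.
    apply: porbit_mul_tperm; rewrite porbit_sym //.
    by rewrite porbit_fixed // inE.
  rewrite E imset_f // !finset.subsetD1 -E zA xz /= E porbit_sym; split => //.
rewrite !finset.subsetD1 => /andP[/andP[zA xz] yz].
have E : porbit (s * tperm x y)%g z = porbit s z by apply: porbit_mul_tperm.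
by rewrite -E imset_f // E zA xz.
Qed.

End PermSum.

(* [\sum_n N n X^n = N 0 * exp(\sum_k w k X^k / k)], as a coefficient recurrence. *)
Definition exp_rec (K : pzRingType) (w N : nat -> K) :=
  forall n, n%:R * N n = \sum_(k < n) w k.+1 * N (n - k.+1)%N.

(** The exponential formula for cycles: detaching the cycle through a root turns the sum over
    permutations into the recurrence for [N]. *)
Lemma perm_sum_exp_rec (T : finType) (K : comNzRingType) (w N : nat -> K)
    (A : {set T}) :
  N 0%N = 1 -> exp_rec K w N -> perm_sum w A = (#|A|)`!%:R * N #|A|.
Proof.
move=> N0 NS.
(* The induction carries rooted sums with arbitrary [g], since each removal of a root shifts [g]. *)
suff: forall n (B : {set T}), #|B| = n -> perm_sum w B = n`!%:R * N n /\
    forall x g, x \in B -> rooted_sum w B x g =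
      n.-1`!%:R * \sum_(k < n) g k.+1 * N (n - k.+1)%N.
  by move=> /(_ _ A erefl)[].
elim=> [|n IH] B Bn.
  have -> : B = finset.set0 by apply/eqP; rewrite -cards_eq0 Bn.
  split; last by move=> x g; rewrite finset.in_set0.
  rewrite fact0 mul1r N0 /perm_sum (bigD1 1%g) ?perm_on1 //= big1 => [|s]; last first.
    by case/andP => /perm_on_id -> //; rewrite ?eqxx // cards0.
  rewrite addr0 /cycle_weight big1 // => c /andP[/imsetP[z _ ->]].
  by move/fintype.subsetP => /(_ z (porbit_id _ _)); rewrite finset.in_set0.
have Q x g : x \in B -> rooted_sum w B x g =
      n`!%:R * \sum_(k < n.+1) g k.+1 * N (n - k)%N.
  move=> xB; have Bx : #|B :\ x| = n.
    by have := cardsD1 x B; rewrite xB Bn add1n => -[].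
  have [W Q] := IH _ Bx; rewrite rooted_sum_rec // W big_ord_recl subn0.
  under eq_bigr => y yB do rewrite Q //.
  rewrite sumr_const Bx.
  (* For [n = 0] there is no further root to choose; otherwise the [n] possible roots contribute
     equally and turn [(n-1)!] into [n!]. *)
  case: n {IH Bn Q W} Bx => [|n] _; first by rewrite mulr0n big_ord0 fact0; ring.
  rewrite /= factS natrM -mulr_natl mulrDr mulrCA; congr (_ + _).
  rewrite mulr1 -mulrnAl mulr_natl; congr (_ * _); apply: eq_bigr => k _.
split=> //.
have [x xB] : exists x, x \in B by apply/finset.set0Pn; rewrite -card_gt0 Bn.
by rewrite (perm_sum_rooted w B x) // Q // factS natrM -mulrA mulrCA NS.
Qed.

(** * Rising factorials and the Ewens mean *)

Section Weights.
Context {R : realType}.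
Implicit Types (theta : R) (n : nat).

(* The coefficient of [X^n] in [(1 - X)^-theta]. *)
Definition rising_coef theta n : R := (\prod_(0 <= i < n) (theta + i%:R)) / n`!%:R.

Lemma rising_coef0 theta : rising_coef theta 0 = 1.
Proof. by rewrite /rising_coef big_geq // fact0 divr1. Qed.

Lemma rising_coefS theta n :
  n.+1%:R * rising_coef theta n.+1 = (theta + n%:R) * rising_coef theta n.
Proof.
rewrite /rising_coef big_nat_recr //= factS natrM invfM.
have n0 : n.+1%:R != 0 :> R by rewrite pnatr_eq0.
have f0 : n`!%:R != 0 :> R by rewrite pnatr_eq0 -lt0n fact_gt0.
by rewrite -nat1r in n0; field; rewrite f0 n0.
Qed.

Lemma rising_coef_gt0 theta n : 0 < theta -> 0 < rising_coef theta n.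
Proof.
move=> t0; apply: divr_gt0; last by rewrite ltr0n fact_gt0.
by apply: prodr_gt0 => i _; rewrite ltr_wpDr.
Qed.

(** Coefficientwise, this is [X D' = theta X D / (1 - X)] for [D = (1 - X)^-theta]. *)
Lemma sum_rising_coef theta n :
  theta * \sum_(i < n) rising_coef theta i = n%:R * rising_coef theta n.
Proof.
elim: n => [|n IH]; first by rewrite big_ord0 mulr0 mul0r.
by rewrite big_ord_recr /= mulrDr IH rising_coefS; ring.
Qed.

Lemma exp_rec_rising_coef theta : exp_rec R (fun=> theta) (rising_coef theta).
Proof.
move=> n; rewrite -sum_rising_coef mulr_sumr (reindex_inj rev_ord_inj) /=.
by apply: eq_bigr.
Qed.

Lemma cycle_weight_mulfun theta n (f : nat -> R[i]) (s : 'S_n) :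
  cycle_weight (fun k => theta%:C * f k) [set: 'I_n]%SET s
  = mulfun f s * (theta ^+ cycle_count s)%:C.
Proof.
have E (w : nat -> R[i]) : cycle_weight w [set: 'I_n]%SET s =
    \prod_(1 <= k < n.+1) w k ^+ cycle_mult s k.
  rewrite /cycle_weight (eq_bigl (mem (porbits s))); last first.
    by move=> c; rewrite finset.subsetT andbT.
  transitivity (\prod_(c in porbits s) \prod_(1 <= k < n.+1 | k == #|c|) w k).
    apply: eq_bigr => c /imsetP[z _ ->]; rewrite big_nat1_eq ltnS.
    have := max_card (mem (porbit s z)); rewrite card_ord => ->.
    by rewrite lt0n card_porbit_neq0.
  rewrite (exchange_big_dep predT) //=; apply: eq_bigr => k _.
  rewrite prodr_const /cycle_mult; congr (_ ^+ _); apply: eq_card => c.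
  by rewrite !inE eq_sym.
rewrite E /mulfun /cycle_count; under eq_bigr do rewrite exprMn.
rewrite big_split /= mulrC; congr (_ * _).
by rewrite rmorphXn expr_sum.
Qed.

(** The Ewens normalizer is [n!] times [rising_coef theta n], and this [n!] cancels the one from the
    exponential formula. *)
Lemma mean_value_exp_rec theta n (f N : nat -> R[i]) : 0 < theta ->
  N 0%N = 1 -> exp_rec _ (fun k => theta%:C * f k) N ->
  mean_value theta (mulfun (n := n) f) = N n / (rising_coef theta n)%:C.
Proof.
move=> t0 N0 NS.
have E : perm_sum (fun k => theta%:C * f k) [set: 'I_n]%SET = n`!%:R * N n.
  by rewrite (perm_sum_exp_rec _ _ _ _ _ N0 NS) cardsT card_ord.
rewrite /mean_value /ewens.
transitivity (((\prod_(0 <= i < n) (theta + i%:R))^-1)%:C *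
   perm_sum (fun k => theta%:C * f k) [set: 'I_n]%SET).
  rewrite mulr_sumr; apply: eq_big => s.
    by symmetry; apply/fintype.subsetP => z _; rewrite inE.
  move=> _; rewrite cycle_weight_mulfun rmorphM /= [LHS]mulrA; exact: mulrC.
rewrite E /rising_coef -(fmorphV (real_complex R)) invfM invrK.
rewrite (rmorphM (real_complex R)) (rmorph_nat (real_complex R)) /=.
by rewrite [RHS]mulrC -mulrA.
Qed.

End Weights.

(** * Power sums and Hoelder's inequality *)

Section RealEstimates.
Context {R : realType}.
Implicit Types (theta p q a y : R) (m n : nat).

(** Young's inequality for the product [y * 1], with the exponent [q / (q - 1)] conjugate to [q]. *)
Lemma bernoulli_powR q y : 1 < q -> 0 <= y -> 1 + q * (y - 1) <= y `^ q.
Proof.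
move=> q1 y0; have q0 : 0 < q by lra.
have r0 : 0 < q / (q - 1) by apply: divr_gt0 => //; lra.
have qr : q^-1 + (q / (q - 1))^-1 = 1.
  by field; apply/andP; split; apply/eqP; lra.
have := conjugate_powR y0 ler01 q0 r0 qr; rewrite powR1 mulr1 => H.
have : y * q <= (y `^ q / q + 1 / (q / (q - 1))) * q by rewrite ler_pM2r.
have -> : (y `^ q / q + 1 / (q / (q - 1))) * q = y `^ q + q - 1.
  by field; apply/andP; split; apply/eqP; lra.
lra.
Qed.

(** The previous inequality with exponent [a^-1], taken at the [a]-th power of [y]. *)
Lemma bernoulli_powR_lt1 a y : 0 < a < 1 -> 0 <= y -> y `^ a <= 1 + a * (y - 1).
Proof.
move=> /andP[a0 a1] y0.
have := @bernoulli_powR a^-1 (y `^ a); rewrite -powRrM mulfV ?gt_eqF // powRr1 //.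
rewrite invf_gt1 // => /(_ a1 (powR_ge0 _ _)) H.
have : a * (1 + a^-1 * (y `^ a - 1)) <= a * y by rewrite ler_pM2l.
rewrite mulrDr mulrA mulfV ?gt_eqF //; lra.
Qed.

(* For [q] conjugate to [p], the last hypothesis says [p * theta > 1]. *)
Lemma sum_rising_coef_powR theta q m :
  0 < theta -> 1 < q -> 0 < 1 - q * (1 - theta) ->
  \sum_(i < m) rising_coef theta i `^ q
    <= (1 - q * (1 - theta))^-1 * (m%:R * rising_coef theta m `^ q).
Proof.
move=> t0 q1; set c := 1 - q * _ => c0.
have cc : c * c^-1 = 1 by rewrite mulfV ?gt_eqF.
elim: m => [|m IH]; first by rewrite big_ord0 mul0r mulr0.
rewrite big_ord_recr /=; apply: (le_trans (lerD IH (lexx _))).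
have m1 : 0 < m.+1%:R :> R by rewrite ltr0n.
have dE : rising_coef theta m.+1 = (theta + m%:R) / m.+1%:R * rising_coef theta m.
  by apply: (mulfI (lt0r_neq0 m1));
    rewrite rising_coefS [RHS]mulrA [X in _ = X * _]mulrC divfK ?gt_eqF.
rewrite dE powRM ?(ltW (rising_coef_gt0 _ _ t0)) //; last first.
  by rewrite divr_ge0 ?addr_ge0 // ltW.
have D0 : 0 <= rising_coef theta m `^ q by exact: powR_ge0.
set D := (_ `^ q) in D0 *.
have Y0 : 0 <= (theta + m%:R) / m.+1%:R by rewrite divr_ge0 ?addr_ge0 // ltW.
have := bernoulli_powR q _ q1 Y0; set Y := (X in _ <= X) => HY.
(* Bernoulli's inequality for the ratio of consecutive coefficients, whose [q]-th power is [Y]; the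
   constant [c] is exactly what the induction step requires. *)
have HY2 : m%:R + c <= m.+1%:R * Y.
  have : m.+1%:R * (1 + q * ((theta + m%:R) / m.+1%:R - 1)) <= m.+1%:R * Y.
    by rewrite ler_pM2l.
  have -> : m.+1%:R * (1 + q * ((theta + m%:R) / m.+1%:R - 1)) = m%:R + c.
    rewrite /c -(natr1 m); rewrite -(natr1 m) in m1.
    by field; rewrite gt_eqF // addrC.
  by [].
rewrite -/Y [leRHS](_ : _ = c^-1 * (m.+1%:R * Y) * D); last by ring.
apply: (@le_trans _ _ (c^-1 * (m%:R + c) * D)); last first.
  by rewrite ler_wpM2r // ler_pM2l // invr_gt0.
by rewrite mulrDr mulrDl -[X in _ <= _ + X * D](mulrC c) cc mul1r mulrA.
Qed.

Lemma hoelder_sum p q n (a b : 'I_n -> R) :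
  0 < p -> 0 < q -> p^-1 + q^-1 = 1 ->
  (forall i, 0 <= a i) -> (forall i, 0 <= b i) ->
  \sum_i a i * b i <= (\sum_i a i `^ p) `^ p^-1 * (\sum_i b i `^ q) `^ q^-1.
Proof.
move=> p0 q0 pq a0 b0.
(* A vanishing norm forces all entries to vanish; this settles the cases in which normalizing is
   impossible. *)
have nz (r : R) (u : 'I_n -> R) : 0 < r -> (forall i, 0 <= u i) ->
    (\sum_i u i `^ r) `^ r^-1 = 0 -> forall i, u i = 0.
  move=> r0 u0 /eqP; rewrite powR_eq0 => /andP[/eqP S0 _] i.
  have /psumr_eq0P : forall i, true -> 0 <= u i `^ r by move=> *; exact: powR_ge0.
  by move=> /(_ S0 i isT) /powR_eq0_eq0.
have az := nz p a p0 a0; have bz := nz q b q0 b0.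
have pow (r : R) (u : 'I_n -> R) : 0 < r -> (forall i, 0 <= u i) ->
    ((\sum_i u i `^ r) `^ r^-1) `^ r = \sum_i u i `^ r.
  move=> r0 u0; rewrite -powRrM mulVf ?gt_eqF // powRr1 // sumr_ge0 // => i _.
  exact: powR_ge0.
move: az bz (pow p a p0 a0) (pow q b q0 b0).
move: (_ `^ p^-1) (_ `^ q^-1) (powR_ge0 (\sum_i a i `^ p) p^-1)
  (powR_ge0 (\sum_i b i `^ q) q^-1) => A B A0 B0 az bz AE BE.
have [Az|An] := eqVneq A 0.
  by rewrite Az mul0r big1 // => i _; rewrite az // mul0r.
have [Bz|Bn] := eqVneq B 0.
  by rewrite Bz mulr0 big1 // => i _; rewrite bz // mulr0.
have Ap : 0 < A by rewrite lt0r An.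
have Bp : 0 < B by rewrite lt0r Bn.
have normalize (r V : R) (u : 'I_n -> R) : 0 < V -> (forall i, 0 <= u i) ->
    V `^ r = \sum_i u i `^ r -> \sum_i (u i / V) `^ r = 1.
  move=> V0 u0 VE.
  under eq_bigr => i _ do rewrite powRM ?invr_ge0 ?(ltW V0) //.
  rewrite -mulr_suml -VE -powRM ?(ltW V0) ?invr_ge0 ?(ltW V0) //.
  by rewrite mulfV ?gt_eqF // powR1.
(* Young's inequality termwise, for both sequences scaled to norm one. *)
have : \sum_i (a i / A) * (b i / B) <= 1.
  rewrite -pq; apply: (@le_trans _ _
    (\sum_i ((a i / A) `^ p / p + (b i / B) `^ q / q))).
    apply: ler_sum => i _; apply: conjugate_powR => //; exact: divr_ge0.
  by rewrite big_split /= -!mulr_suml !normalize // !mul1r.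
rewrite (eq_bigr (fun i => (a i * b i) / (A * B))); last first.
  by move=> i _; rewrite invfM; ring.
by rewrite -mulr_suml ler_pdivrMr ?mulr_gt0 // mul1r.
Qed.

(** Concavity gives [(m / (m+1))^a <= 1 - a / (m+1)]; the factor 2 pays for [1/m <= 2 / (m+1)]. This
    makes the increments of the averages telescope. *)
Lemma powR_telescope a m : 0 < a < 1 -> (0 < m)%N ->
  m%:R^-1 * m%:R `^ (- a) <= 2 / a * (m%:R `^ (- a) - m.+1%:R `^ (- a)).
Proof.
move=> a01; have /andP[a0 a1] := a01; case: m => [//|m _].
have m0 : 0 < m.+1%:R :> R by rewrite ltr0n.
have M0 : 0 < m.+2%:R :> R by rewrite ltr0n.
have ME : m.+2%:R = m.+1%:R + 1 :> R by rewrite natr1.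
have m1 : 1 <= m.+1%:R :> R by rewrite ler1n.
set x : R := m.+1%:R in m0 m1 ME *; set X : R := m.+2%:R in M0 ME *.
have -> : X `^ (- a) = x `^ (- a) * (x / X) `^ a.
  rewrite powRM ?(ltW m0) ?invr_ge0 ?(ltW M0) // mulrA -powRD; last first.
    by apply/implyP => _; rewrite gt_eqF.
  by rewrite addNr powRr0 mul1r -[X^-1]powR_inv1 ?(ltW M0) // -powRrM mulN1r.
have := bernoulli_powR_lt1 a (x / X) a01 (divr_ge0 (ltW m0) (ltW M0)).
set Y := _ `^ a => HY.
have P0 : 0 <= x `^ (- a) by exact: powR_ge0.
set P := x `^ _ in P0 *.
have -> : 2 / a * (P - P * Y) = (2 / a * (1 - Y)) * P by ring.
apply: ler_wpM2r => //.
have : 2 / a * (a * (1 - x / X)) <= 2 / a * (1 - Y).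
  rewrite ler_pM2l; last exact: divr_gt0.
    clearbody x X Y P; lra.
apply: le_trans.
have -> : 2 / a * (a * (1 - x / X)) = 2 / X.
  by rewrite ME; rewrite ME in M0; field; rewrite !gt_eqF.
by rewrite ler_pdivlMr // ler_pdivrMl // ME; lra.
Qed.

End RealEstimates.

(** * Moduli of complex numbers *)

Section Cmod.
Context {R : realType}.
Implicit Types (x y z : R[i]).

Lemma natr_complex (m : nat) : m%:R = (m%:R : R)%:C.
Proof. by rewrite (rmorph_nat (real_complex R)). Qed.

Lemma cmodE z : `|z| = (cmod z)%:C. Proof. by case: z. Qed.

Lemma cmodM x y : cmod (x * y) = cmod x * cmod y.
Proof. exact: ComplexField.Normc.normcM. Qed.

Lemma cmodV x : cmod x^-1 = (cmod x)^-1.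
Proof. exact: ComplexField.Normc.normcV. Qed.

Lemma ler_cmodD x y : cmod (x + y) <= cmod x + cmod y.
Proof. by rewrite -lecR rmorphD /= -!cmodE ler_normD. Qed.

Lemma cmod0 : cmod (0 : R[i]) = 0.
Proof. exact: ComplexField.Normc.normc0. Qed.

Lemma cmod_ge0 x : 0 <= cmod x.
Proof. by rewrite -lecR -cmodE normr_ge0. Qed.

Lemma cmodB x y : cmod (x - y) = cmod (y - x).
Proof.
apply/eqP; rewrite eq_le -!lecR -!cmodE.
by rewrite distrC lexx.
Qed.

Lemma cmodR (r : R) : 0 <= r -> cmod r%:C = r.
Proof. by move=> r0; rewrite /cmod /= expr0n /= addr0 sqrtr_sqr ger0_norm. Qed.

Lemma ler_cmod_sum n (F : 'I_n -> R[i]) :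
  cmod (\sum_(i < n) F i) <= \sum_(i < n) cmod (F i).
Proof.
elim/big_ind2: _ => //; first by rewrite cmod0.
by move=> x u y v xu yv; apply: (le_trans (ler_cmodD _ _)); exact: lerD.
Qed.

Lemma ler_cmod_ReIm z : cmod z <= `|complex.Re z| + `|complex.Im z|.
Proof.
case: z => a b /=; rewrite /cmod /=.
rewrite -[leRHS]ger0_norm ?addr_ge0 // -sqrtr_sqr ler_wsqrtr //.
by rewrite sqrrD !real_normK ?num_real // addrAC lerDl mulrn_wge0 // mulr_ge0.
Qed.

End Cmod.

(** * Algebra of weighted averages *)

Section Algebra.
Context {K : fieldType}.
Implicit Types (t m S e N T d : K).

(** Meant for partial sums [S], [T] of [N] and [d]: dividing the two relations cancels the factor
    [t / m]. *)
Lemma mean_decomp {t m S e N T d} : t != 0 -> m != 0 -> T != 0 ->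
  m * N = t * (S + e) -> t * T = m * d -> N / d = S / T + e / T.
Proof.
move=> t0 m0 T0 mN tT.
have -> : N = t * (S + e) / m by rewrite -mN; field.
have -> : d = t * T / m by rewrite tT; field.
by field; rewrite t0 m0 T0.
Qed.

(** The main parts of [T N - S d] cancel; the error that remains carries an additional factor
    [1 / m]. *)
Lemma mean_increment {t m S e N T d} : m != 0 -> T != 0 -> T + d != 0 ->
  m * N = t * (S + e) -> t * T = m * d ->
  (S + N) / (T + d) - S / T = t * e / (m * (T + d)).
Proof.
move=> m0 T0 Td0 mN tT.
have NE : N = t * (S + e) / m by rewrite -mN; field.
have dE : d = t * T / m by rewrite tT; field.
rewrite NE dE; rewrite dE in Td0.
field; rewrite T0 m0 /= andbT.
by rewrite (_ : _ + _ = m * (T + t * T / m)) ?mulf_neq0 //; field.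
Qed.

End Algebra.

(** * Variation of the mean value *)

Section Comparison.
Context {R : realType}.
Variables (theta : R) (f N : nat -> R[i]).
Hypothesis t0 : 0 < theta.
Hypothesis f1 : forall k, cmod (f k) <= 1.
Hypothesis N0 : N 0%N = 1.
Hypothesis NR : exp_rec _ (fun k => theta%:C * f k) N.

Local Notation d := (rising_coef theta).
Local Notation T := (fun m => \sum_(j < m) d j).

(** The coefficients [d] solve the recurrence with all weights equal to [theta], which dominate
    those of [N] in modulus. *)
Lemma cmod_exp_rec m : cmod (N m) <= d m.
Proof.
elim/ltn_ind: m => -[_|m IH].
  by rewrite N0 rising_coef0 /cmod ComplexField.Normc.normc1.
have m1 : 0 < m.+1%:R :> R by rewrite ltr0n.
rewrite -(ler_pM2l m1) exp_rec_rising_coef.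
rewrite -[X in X * _](cmodR _ (ltW m1)) -natr_complex -cmodM NR.
apply: (le_trans (ler_cmod_sum _ _)); apply: ler_sum => k _.
rewrite !cmodM cmodR ?(ltW t0) // -mulrA ler_pM2l //.
rewrite -[leRHS]mul1r; apply: ler_pM; rewrite ?cmod_ge0 //.
by apply: IH; rewrite subSS ltnS leq_subr.
Qed.

Definition weight_error m : R[i] :=
  \sum_(k < m) (f k.+1 - 1) * N (m - k.+1)%N.

Lemma exp_rec_split m :
  m%:R * N m = theta%:C * (\sum_(j < m) N j + weight_error m).
Proof.
have -> : \sum_(j < m) N j = \sum_(k < m) N (m - k.+1)%N.
  by rewrite (reindex_inj rev_ord_inj).
rewrite NR mulrDr !mulr_sumr -big_split /=.
by apply: eq_bigr => k _; ring.
Qed.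

(** Hoelder is applied after majorizing [N] by [d]; the power sums of [d] then give
    [(m * d_m^q)^(1/q)], which is [m * m^(-1/p) * d_m]. *)
Lemma cmod_weight_error p q m : 1 < p -> 1 < p * theta -> q = p / (p - 1) ->
  cmod (weight_error m) <= (1 - q * (1 - theta))^-1 `^ q^-1 *
    (\sum_(k < m) cmod (f k.+1 - 1) `^ p) `^ p^-1
    * m%:R `^ (- p^-1) * (m%:R * d m).
Proof.
case: m => [|m] p1 pt qE.
  by rewrite /weight_error big_ord0 cmod0 !mul0r mulr0.
have p0 : 0 < p by lra.
have q1 : 1 < q by rewrite qE ltr_pdivlMr; lra.
have q0 : 0 < q by lra.
have pq : p^-1 + q^-1 = 1.
  by rewrite qE; field; apply/andP; split; apply/eqP; lra.
(* Here [p * theta > 1] provides the positivity. *)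
have c0 : 0 < 1 - q * (1 - theta).
  have -> : 1 - q * (1 - theta) = (p * theta - 1) / (p - 1).
    by rewrite qE; field; apply/eqP; lra.
  by apply: divr_gt0; lra.
have m0 : 0 < m.+1%:R :> R by rewrite ltr0n.
have d0 i : 0 <= d i by exact/ltW/rising_coef_gt0.
apply: (@le_trans _ _ (\sum_(k < m.+1) cmod (f k.+1 - 1) * d (m.+1 - k.+1))).
  apply: (le_trans (ler_cmod_sum _ _)); apply: ler_sum => k _.
  by rewrite cmodM ler_wpM2l ?cmod_ge0 // cmod_exp_rec.
have := @hoelder_sum R p q m.+1 (fun k => cmod (f k.+1 - 1))
  (fun k => d (m.+1 - k.+1)) p0 q0 pq (fun=> cmod_ge0 _) (fun=> d0 _).
move=> /le_trans; apply.
rewrite [leRHS](_ : _ = (\sum_(k < m.+1) cmod (f k.+1 - 1) `^ p) `^ p^-1 *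
    ((1 - q * (1 - theta))^-1 `^ q^-1 *
      (m.+1%:R * m.+1%:R `^ (- p^-1) * d m.+1))); last by ring.
apply: ler_wpM2l; first exact: powR_ge0.
have -> : m.+1%:R * m.+1%:R `^ (- p^-1) * d m.+1 =
    (m.+1%:R * d m.+1 `^ q) `^ q^-1.
  rewrite powRM ?powR_ge0 ?(ltW m0) // -powRrM mulfV ?gt_eqF // powRr1 //.
  congr (_ * _); rewrite -{1}[m.+1%:R]powRr1 ?(ltW m0) // -powRD; last first.
    by apply/implyP => _; rewrite gt_eqF.
  by congr (_ `^ _); lra.
rewrite -powRM ?invr_ge0 ?(ltW c0) //; last first.
  by rewrite mulr_ge0 ?powR_ge0 // ltW.
apply: ge0_ler_powR; rewrite ?invr_ge0 ?(ltW q0) //.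
- by rewrite nnegrE; apply: sumr_ge0 => i _; exact: powR_ge0.
- by rewrite nnegrE !mulr_ge0 ?powR_ge0 ?invr_ge0 // ltW.
apply: le_trans (sum_rising_coef_powR _ _ _ t0 q1 c0).
by rewrite [leRHS](reindex_inj rev_ord_inj).
Qed.

Lemma mean_variation p q n m : 1 < p -> 1 < p * theta -> q = p / (p - 1) ->
  (0 < n)%N -> (n <= m)%N -> (forall k, (n < k)%N -> f k = 1) ->
  cmod (N n / (d n)%:C - N m / (d m)%:C) <=
    2 * theta * (1 - q * (1 - theta))^-1 `^ q^-1 * (1 + theta * p)
      * ((\sum_(k < n) cmod (f k.+1 - 1) `^ p) `^ p^-1 * n%:R `^ (- p^-1)).
Proof.
move=> p1 pt qE n0 nm fn; set c := _ `^ q^-1.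
have a01 : 0 < p^-1 < 1 by rewrite invr_gt0 invf_lt1; lra.
set H := (\sum_(k < n) _) `^ _.
have c_ge0 : 0 <= c by exact: powR_ge0.
have H_ge0 : 0 <= H by exact: powR_ge0.
have T_gt0 j : (0 < j)%N -> 0 < T j.
  case: j => // j _; rewrite /= big_ord_recr /=.
  by rewrite ltr_wpDl ?rising_coef_gt0 // sumr_ge0 // => i _; exact/ltW/rising_coef_gt0.
have TE j : theta * T j = j%:R * d j by exact: sum_rising_coef.
(* All deviations beyond index [n] vanish, so the same [H] serves for every [j >= n]. *)
have eH j : (n <= j)%N ->
    cmod (weight_error j) <= c * H * j%:R `^ (- p^-1) * (theta * T j).
  move=> nj; rewrite TE; apply: (le_trans (cmod_weight_error p q j p1 pt qE)).
  rewrite -/c /H -!(big_mkord xpredT (fun k => cmod (f k.+1 - 1) `^ p)).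
  rewrite (big_cat_nat (leq0n n) nj) /= [X in _ + X]big_nat_cond
    [X in _ + X]big1 ?addr0 //.
  move=> k /andP[/andP[nk _] _]; rewrite fn // subrr cmod0 powR0 // gt_eqF //.
  by lra.
have C0 (x : R) : 0 < x -> x%:C != 0.
  by move=> x0; rewrite (fmorph_eq0 (real_complex R)) gt_eqF.
pose s j := (\sum_(i < j) N i) / (T j)%:C.
have TEC j : theta%:C * (T j)%:C = j%:R * (d j)%:C.
  by rewrite natr_complex -!rmorphM /= TE.
have Ms j : (n <= j)%N ->
    cmod (N j / (d j)%:C - s j) <= theta * c * H * j%:R `^ (- p^-1).
  move=> nj; have j0 : (0 < j)%N by exact: leq_trans nj.
  have j0C : j%:R != 0 :> R[i] by rewrite natr_complex C0 // ltr0n.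
  have Tj := T_gt0 _ j0.
  rewrite (mean_decomp (C0 _ t0) j0C (C0 _ Tj) (exp_rec_split j) (TEC j)).
  rewrite /s addrC addKr cmodM cmodV cmodR ?(ltW Tj) // ler_pdivrMr //.
  by apply: (le_trans (eH j nj)); rewrite le_eqVlt; apply/predU1P; left; ring.
(* The increment is at most a constant times [j^(-1 - 1/p)], which is bounded by a telescoping
   difference. *)
have ss j : (n <= j)%N -> cmod (s j.+1 - s j) <=
    theta ^+ 2 * c * H * (2 * p) * (j%:R `^ (- p^-1) - j.+1%:R `^ (- p^-1)).
  move=> nj; have j0 : (0 < j)%N by exact: leq_trans nj.
  have j0C : j%:R != 0 :> R[i] by rewrite natr_complex C0 // ltr0n.
  have jR : 0 < j%:R :> R by rewrite ltr0n.
  have Tj := T_gt0 _ j0; have Tj1 := T_gt0 _ (ltn0Sn j).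
  have TS : (T j.+1)%:C = (T j)%:C + (d j)%:C by rewrite -rmorphD /= big_ord_recr.
  rewrite /s TS big_ord_recr /=.
  rewrite (mean_increment j0C (C0 _ Tj) _ (exp_rec_split j) (TEC j)); last first.
    by rewrite -TS C0.
  rewrite -TS cmodM cmodV !cmodM natr_complex !cmodR ?(ltW t0) ?(ltW jR) ?(ltW Tj1) //.
  have tel := powR_telescope p^-1 j a01 j0; rewrite invrK in tel.
  have -> : theta ^+ 2 * c * H * (2 * p) * (j%:R `^ (- p^-1) - j.+1%:R `^ (- p^-1))
     = (theta ^+ 2 * c * H) * (2 * p * (j%:R `^ (- p^-1) - j.+1%:R `^ (- p^-1))) by ring.
  apply: (@le_trans _ _ (theta ^+ 2 * c * H * (j%:R^-1 * j%:R `^ (- p^-1)))); last first.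
    by apply: ler_wpM2l => //; rewrite !mulr_ge0 // ltW.
  rewrite ler_pdivrMr ?mulr_gt0 //.
  have -> : theta ^+ 2 * c * H * (j%:R^-1 * j%:R `^ (- p^-1)) * (j%:R * T j.+1)
     = theta * (c * H * j%:R `^ (- p^-1) * (theta * T j.+1)).
    by field; rewrite gt_eqF.
  rewrite ler_pM2l //; apply: (le_trans (eH j nj)).
  apply: ler_wpM2l; first by rewrite !mulr_ge0 // powR_ge0.
  by rewrite ler_pM2l //= big_ord_recr /= lerDl ltW // rising_coef_gt0.
have sn j : (n <= j)%N -> cmod (s j - s n) <=
    theta ^+ 2 * c * H * (2 * p) * (n%:R `^ (- p^-1) - j%:R `^ (- p^-1)).
  elim: j => [|j IH]; first by case: (n) n0.
  rewrite leq_eqVlt => /predU1P[<-|]; first by rewrite !subrr cmod0 mulr0.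
  rewrite ltnS => nj.
  rewrite (_ : s j.+1 - s n = (s j.+1 - s j) + (s j - s n)); last by ring.
  apply: (le_trans (ler_cmodD _ _)); apply: (le_trans (lerD (ss j nj) (IH nj))).
  by rewrite -mulrDr addrC addrA subrK.
(* The path runs from the mean at [n] through the averages [s n] and [s m] to the mean at [m]. *)
have -> : N n / (d n)%:C - N m / (d m)%:C = (N n / (d n)%:C - s n) -
    (s m - s n) - (N m / (d m)%:C - s m) by ring.
have cN (x y : R[i]) : cmod (x - y) <= cmod x + cmod y.
  by apply: (le_trans (ler_cmodD _ _)); rewrite -[- y]sub0r cmodB subr0.
apply: (le_trans (cN _ _)).
apply: (le_trans (lerD (le_trans (cN _ _) (lerD (Ms n (leqnn n)) (sn m nm))) (Ms m nm))).
have nmP : m%:R `^ (- p^-1) <= n%:R `^ (- p^-1).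
  rewrite !powRN lef_pV2 ?posrE ?powR_gt0 ?ltr0n ?(leq_trans n0 nm) //.
  by apply: ge0_ler_powR; rewrite ?nnegrE ?ler_nat ?invr_ge0 //; lra.
have P0 : 0 <= m%:R `^ (- p^-1) by exact: powR_ge0.
set P := m%:R `^ _ in nmP P0 *; set Q := n%:R `^ _ in nmP *.
(* The two ends contribute [theta] each and the telescoped middle [2 * p * theta^2]; this is the
   origin of the constant. *)
have -> : 2 * theta * c * (1 + theta * p) * (H * Q) =
  theta * c * H * Q + theta ^+ 2 * c * H * (2 * p) * Q + theta * c * H * Q by ring.
apply: lerD; last by rewrite ler_wpM2l // !mulr_ge0 // ltW.
rewrite lerD2l ler_wpM2l // ?lerBlDr ?lerDl //.
by rewrite !mulr_ge0 ?exprn_ge0 ?(ltW t0) //; apply: ltW; apply: lt_trans p1.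
Qed.

End Comparison.

(** * The limit of the mean values *)

Section Convolution.
Context {K : comNzRingType}.
Implicit Types (j m : nat) (c : K) (u x w : nat -> K).

(* Coefficients of [(\sum_i u i * X^(j * i)) * (\sum_m x m * X^m)]. *)
Definition step_conv j u x m : K :=
  \sum_(i < m.+1 | (j * i <= m)%N) u i * x (m - j * i)%N.

Lemma step_conv0 j u x : step_conv j u x 0 = u 0%N * x 0%N.
Proof. by rewrite /step_conv big_mkcond big_ord1 muln0. Qed.

Lemma step_conv_widen j u x m M : (0 < j)%N -> (m < M)%N ->
  step_conv j u x m = \sum_(i < M | (j * i <= m)%N) u i * x (m - j * i)%N.
Proof.
move=> j0 mM; rewrite /step_conv.
rewrite (big_ord_widen_cond M (fun i => (j * i <= m)%N)
  (fun i => u i * x (m - j * i)%N)) //.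
apply: eq_bigl => i /=; apply/andb_idr => jim.
by rewrite ltnS; apply: leq_trans jim; rewrite leq_pmull.
Qed.

(** Formally [u] holds the coefficients of a multiple of [exp(c X)]; the factor [exp(c X^j)] adds
    [c X^j] to the exponent, hence [j * c] to the weight at [j]. *)
Lemma exp_rec_step_conv j c u x w : (0 < j)%N ->
  (forall i, i.+1%:R * u i.+1 = c * u i) -> exp_rec K w x ->
  exp_rec K (fun k => w k + (j%:R * c) *+ (k == j)) (step_conv j u x).
Proof.
move=> j0 uS xw m.
have {}xw l : l%:R * x l = \sum_(k < l) w k.+1 * x (l - k.+1)%N := xw l.
under [RHS]eq_bigr do rewrite mulrDl.
rewrite big_split /=.
(* Product rule: [m] is split as [(m - j * i) + j * i]. *)
have -> : m%:R * step_conv j u x m =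
    \sum_(i < m.+1 | (j * i <= m)%N) u i * ((m - j * i)%:R * x (m - j * i)%N)
  + \sum_(i < m.+1 | (j * i <= m)%N) (j%:R * (i%:R * u i)) * x (m - j * i)%N.
  rewrite /step_conv mulr_sumr -big_split /=; apply: eq_bigr => i jim.
  by rewrite -{1}(subnK jim) natrD natrM; ring.
congr (_ + _).
  under [LHS]eq_bigr => i jim do
     rewrite xw (big_ord_widen m (fun k => w k.+1 * x (m - j * i - k.+1)%N)) ?leq_subr //
      mulr_sumr.
  rewrite (exchange_big_dep xpredT) //=; apply: eq_bigr => k _.
  rewrite (@step_conv_widen _ _ _ _ m.+1) ?ltnS ?leq_subr // mulr_sumr.
  apply: eq_big => [i|i _]; last first.
    by rewrite mulrCA -subnDA addnC subnDA.
  by have := ltn_ord k; lia.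
(* The term [i = 0] vanishes; the relation for [u] shifts the others down by one, to match the
   single weight at [k.+1 = j]. *)
rewrite big_mkcond big_ord_recl -big_mkcond /= muln0 leq0n mul0r mulr0 mul0r add0r.
have [jm|mj] := leqP j m; last first.
  rewrite big1 ?big1 // => [k _|i]; last by rewrite /bump /=; lia.
  by rewrite (_ : (k.+1 == j) = false) ?mulr0n ?mul0r //; have := ltn_ord k; lia.
have jm' : (j.-1 < m)%N by lia.
rewrite [RHS](bigD1 (Ordinal jm')) //= [X in _ + X]big1 ?addr0; last first.
  move=> k; rewrite -val_eqE /= => kj.
  by rewrite (_ : (k.+1 == j) = false) ?mulr0n ?mul0r //; lia.
rewrite prednK // eqxx mulr1n (@step_conv_widen _ _ _ _ m) //; last by lia.
rewrite mulr_sumr; apply: eq_big => [i|i _]; rewrite /bump /= add1n ?mulnS.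
  by lia.
by rewrite uS subnDA; ring.
Qed.

End Convolution.

(** * Dominated convergence and ratios of coefficients *)

Section Limits.
Local Open Scope classical_set_scope.
Context {R : realType}.
Implicit Types (theta r x : R) (b u v : nat -> R).

(** Dominated convergence for series: past a fixed index [I] both tails are small uniformly in [m],
    and below [I] the sum is finite. *)
Lemma tannery (a : nat -> nat -> R) b u (U : R) :
  (forall m i, `|a m i| <= b i) -> cvgn (series b) ->
  (forall i, a m i @[m --> \oo] --> u i) -> series u @ \oo --> U ->
  (\sum_(i < m.+1) a m i) @[m --> \oo] --> U.
Proof.
move=> ab bB au uU; apply/cvgrPdist_le => e e0.
have e3 : 0 < e / 3 by rewrite divr_gt0.
have /cvgrPdist_le/(_ _ e3) near_b := bB.
have /cvgrPdist_le/(_ _ e3) near_u := uU.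
have [I [bI uI]] : exists I, `|limn (series b) - series b I| <= e / 3 /\
    `|U - series u I| <= e / 3.
  by near \oo => I; exists I; split; near: I.
have b0 i : 0 <= b i by apply: le_trans (ab 0%N i).
have : (\sum_(i < I) a m i) @[m --> \oo] --> \sum_(i < I) u i.
  elim: I {bI uI} => [|I IH].
    rewrite big_ord0; under eq_cvg do rewrite big_ord0.
    exact: cvg_cst.
  rewrite big_ord_recr; under eq_cvg do rewrite big_ord_recr.
  exact: cvgD.
move=> /cvgrPdist_le/(_ _ e3) near_a.
near=> m.
have Im : (I <= m.+1)%N by near: m; exists I => // k /= /leqW.
have aI : `|\sum_(i < I) u i - \sum_(i < I) a m i| <= e / 3 by near: m.
have tail : `|\sum_(I <= i < m.+1) a m i| <= e / 3.
  apply: (le_trans (ler_norm_sum _ _ _)).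
  apply: (@le_trans _ _ (\sum_(I <= i < m.+1) b i)); first exact: ler_sum.
  apply: le_trans bI; apply: le_trans (ler_norm _); rewrite lerBrDr addrC.
  have -> : series b I + \sum_(I <= i < m.+1) b i = series b m.+1.
    by rewrite /series /= -big_cat_nat.
  by apply: nondecreasing_cvgn_le => //; exact: nondecreasing_series.
rewrite -(big_mkord xpredT) (big_cat_nat (leq0n I) Im) /= big_mkord.
rewrite [series u I]/series /= big_mkord in uI.
set x := \sum_(i < I) u i in uI aI; set y := \sum_(i < I) a m i in aI *.
set z := \sum_(I <= i < m.+1) _ in tail *.
have -> : U - (y + z) = (U - x) + (x - y) - z by ring.
apply: (le_trans (ler_normB _ _)); apply: (le_trans (lerD (ler_normD _ _) (lexx _))).
by rewrite -[e]mulr1; apply: (le_trans (lerD (lerD uI aI) tail)); lra.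
Unshelve. all: by end_near. Qed.

Section Ratio.
Variable theta : R.
Hypothesis t0 : 0 < theta.
Local Notation d := (rising_coef theta).

(** The quotient is [d n / d n.+1]; its limit is what makes index shifts harmless. *)
Lemma rising_coef_ratio : (n.+1%:R / (theta + n%:R)) @[n --> \oo] --> (1 : R).
Proof.
have -> : (fun n => n.+1%:R / (theta + n%:R)) =
    (fun n : nat => (1 + (theta - 1) * harmonic n)^-1) :> (nat -> R).
  apply/funext => n; rewrite /harmonic /= -natr1.
  by field; rewrite !gt_eqF // addrACA subrr addr0 ltr_wpDl.
have H : (1 + (theta - 1) * harmonic n) @[n --> \oo] --> (1 + (theta - 1) * 0 : R).
  by apply: cvgD; [exact: cvg_cst | apply: cvgMl_tmp; exact: cvg_harmonic].
rewrite mulr0 addr0 in H.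
by rewrite -[X in _ --> X]invr1; apply: cvgV => //; exact: oner_neq0.
Qed.

Lemma cvg_ratio_shift v (E : R) l :
  v m / d m @[m --> \oo] --> E ->
  (if (l <= m)%N then v (m - l)%N else 0) / d m @[m --> \oo] --> E.
Proof.
move=> vE; suff shift : forall k, v m / d (m + k) @[m --> \oo] --> E.
  rewrite -(cvg_shiftn l); under eq_cvg do rewrite /= leq_addl addnK.
  exact: shift.
move=> {l}; elim=> [|l IH].
  by have -> : (fun m => v m / d (m + 0)) = (fun m => v m / d m)
    by apply/funext => m; rewrite addn0.
have -> : (fun m => v m / d (m + l.+1)) = (fun m =>
    v m / d (m + l) * ((m + l)%N.+1%:R / (theta + (m + l)%:R))).
  apply/funext => m; rewrite addnS.
  have d1 : 0 < d (m + l).+1 by exact: rising_coef_gt0.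
  have d0 : 0 < d (m + l) by exact: rising_coef_gt0.
  have tm : 0 < theta + (m + l)%:R by rewrite ltr_wpDr.
  have dS := rising_coefS theta (m + l).
  have -> : d (m + l) = (m + l)%N.+1%:R * d (m + l).+1 / (theta + (m + l)%:R).
    by rewrite dS [_ * d _]mulrC mulfK // gt_eqF.
  have n0 : (m + l)%N.+1%:R != 0 :> R by rewrite pnatr_eq0.
  move: (d (m + l).+1) d1 n0 tm => D D0; move: (theta + _) ((m + l)%N.+1%:R) => X Y Y0 X0.
  by field; rewrite (gt_eqF X0) (gt_eqF D0) Y0.
rewrite -[X in _ --> X]mulr1; apply: cvgM => //.
by have := rising_coef_ratio; rewrite -(cvg_shiftn l).
Qed.

(** Since [n * d n] is nondecreasing, [d m <= (m + l) / m * d (m + l)] for positive [m]; the summand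
    [theta^-1] covers [m = 0], through [d 1 = theta]. *)
Lemma rising_coef_shift_le m l :
  d m <= (1 + theta^-1) * (1 + l%:R) * d (m + l).
Proof.
have d0 n : 0 < d n by exact: rising_coef_gt0.
have ti : 0 < theta^-1 by rewrite invr_gt0.
have mono n k : n%:R * d n <= (n + k)%:R * d (n + k).
  elim: k => [|k IH]; first by rewrite addn0.
  rewrite addnS; apply: (le_trans IH); rewrite rising_coefS.
  by rewrite mulrDl lerDr mulr_ge0 // ltW.
case: m => [|m].
  rewrite add0n rising_coef0; case: l => [|l].
    by rewrite rising_coef0 addr0 !mulr1 lerDl ltW.
  have := mono 1%N l; rewrite rising_coefS rising_coef0 addr0 mulr1 add1n => H.
  have H1 : 1 <= theta^-1 * (l.+1%:R * d l.+1) by rewrite ler_pdivlMl // mulr1.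
  apply: (le_trans H1); rewrite -mulrA; apply: ler_pM; rewrite ?(ltW ti) //.
  - by rewrite mulr_ge0 // ltW.
  - by rewrite lerDr.
  - by rewrite ler_pM2r // lerDr.
have m0 : 0 < m.+1%:R :> R by rewrite ltr0n.
have m1 : 1 <= m.+1%:R :> R by rewrite ler1n.
have l0 : 0 <= l%:R :> R by [].
rewrite -(ler_pM2l m0); apply: (le_trans (mono _ l)).
rewrite [leRHS]mulrA ler_pM2r // natrD mulrCA.
have : m.+1%:R + l%:R <= m.+1%:R * (1 + l%:R) :> R.
  by rewrite mulrDr mulr1 lerD2l ler_peMl.
move=> /le_trans; apply.
by rewrite ler_peMl ?lerDl ?(ltW ti) //.
Qed.

(** Each shift by [j * i] keeps the limit [E], and the factorial decay of [u] permits passing to the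
    limit term by term. *)
Lemma step_conv_cvg j u v r (U E : R) : (0 < j)%N -> 0 <= r ->
  (forall i, `|u i| <= exp_coeff r i) -> series u @ \oo --> U ->
  v m / d m @[m --> \oo] --> E ->
  step_conv j u v m / d m @[m --> \oo] --> U * E.
Proof.
move=> j0 r0 ur uU vE.
have d0 n : 0 < d n by exact: rising_coef_gt0.
have [B [B0 vB]] : exists B, 0 <= B /\ forall m, `|v m / d m| <= B.
  have [M [_ HM]] := cvg_seq_bounded (cvgP _ vE).
  exists (`|M| + 1); split; first by rewrite addr_ge0.
  by move=> m; apply: (HM (`|M| + 1)) => //; rewrite (le_lt_trans (ler_norm _)) // ltrDl.
pose a m i := u i * ((if (j * i <= m)%N then v (m - j * i)%N else 0) / d m).
have -> : (fun m => step_conv j u v m / d m) = (fun m => \sum_(i < m.+1) a m i).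
  apply/funext => m; rewrite /step_conv big_mkcond mulr_suml; apply: eq_bigr => i _.
  by rewrite /a; case: ifP => _; rewrite ?mul0r ?mulr0 // mulrA.
(* The shift bound costs a factor [1 + j * i], at most [(1 + j) * 2^i]; hence the argument
   [2 * r]. *)
apply: (@tannery a (fun i => (B * (1 + theta^-1) * (1 + j%:R)) * exp_coeff (2 * r) i)
   (fun i => u i * E)).
- move=> m i; rewrite /a normrM.
  have -> : B * (1 + theta^-1) * (1 + j%:R) * exp_coeff (2 * r) i =
     exp_coeff r i * (B * (1 + theta^-1) * (1 + j%:R) * 2 ^+ i).
    by rewrite /exp_coeff /= exprMn; ring.
  apply: ler_pM => //.
  have K0 : 0 <= 1 + theta^-1 by rewrite addr_ge0 // invr_ge0 ltW.
  case: ifP => [jim|_]; last by rewrite mul0r normr0 !mulr_ge0 // ?addr_ge0.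
  have -> : v (m - j * i)%N / d m =
      v (m - j * i)%N / d (m - j * i) * (d (m - j * i) / d m).
    by rewrite mulrA divfK // gt_eqF.
  rewrite normrM.
  rewrite [leRHS](_ : _ = B * ((1 + theta^-1) * ((1 + j%:R) * 2 ^+ i))); last by ring.
  apply: ler_pM => //.
  rewrite (ger0_norm (divr_ge0 (ltW (d0 _)) (ltW (d0 _)))).
  rewrite (ler_pdivrMr _ _ (d0 m)).
  have := rising_coef_shift_le (m - j * i) (j * i); rewrite subnK // => /le_trans; apply.
  rewrite ler_pM2r // ler_wpM2l //.
  rewrite natrM.
  have i2 : 1 + i%:R <= 2 ^+ i :> R by rewrite -natrX nat1r ler_nat ltn_expl.
  have i0 : 0 <= i%:R :> R by [].
  have jr : 0 <= j%:R :> R by [].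
  apply: (@le_trans _ _ ((1 + j%:R) * (1 + i%:R))).
    by rewrite mulrDl mul1r mulrDr mulr1; lra.
  by rewrite ler_wpM2l // addr_ge0.
- exact/is_cvg_seriesZ/is_cvg_series_exp_coeff.
- move=> i; apply: cvgM; first exact: cvg_cst.
  exact: cvg_ratio_shift.
- have -> : series (fun i => u i * E) = (fun n => series u n * E).
    by apply/funext => n; rewrite /series /= mulr_suml.
  by apply: cvgM => //; exact: cvg_cst.
Qed.

End Ratio.
End Limits.

(** * Complex exponentials and limits of coefficient ratios *)

Section ComplexLimit.
Local Open Scope classical_set_scope.
Context {R : realType}.
Implicit Types (a b : R) (x y z : R[i]).
Local Notation Re := (@complex.Re R).
Local Notation Im := (@complex.Im R).

Lemma ReM x y : Re (x * y) = Re x * Re y - Im x * Im y.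
Proof. by case: x; case: y. Qed.

Lemma ImM x y : Im (x * y) = Re x * Im y + Im x * Re y.
Proof. by case: x => p q; case: y. Qed.

Lemma cexpD x y : cexp (x + y) = cexp x * cexp y.
Proof.
case: x => p q; case: y => s t.
rewrite /cexp /= expRD cosD sinD.
by apply/eqP; rewrite eq_complex /=; apply/andP; split; apply/eqP; ring.
Qed.

Lemma cexp0 : cexp (0 : R[i]) = 1.
Proof. by rewrite /cexp /= expR0 cos0 sin0 mul1r. Qed.

Lemma Re_step_conv j (u x : nat -> R[i]) m :
  Re (step_conv j u x m) = step_conv j (Re \o u) (Re \o x) m
    - step_conv j (Im \o u) (Im \o x) m.
Proof.
rewrite /step_conv raddf_sum -sumrB; apply: eq_bigr => i _; exact: ReM.
Qed.

Lemma Im_step_conv j (u x : nat -> R[i]) m :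
  Im (step_conv j u x m) = step_conv j (Re \o u) (Im \o x) m
    + step_conv j (Im \o u) (Re \o x) m.
Proof.
rewrite /step_conv raddf_sum -big_split; apply: eq_bigr => i _; exact: ImM.
Qed.

(** The coefficient of [X^i] in [exp(sqrt(-1) * b * X)]. *)
Definition polar_coeff b i : R[i] := cos_coeff b i +i* sin_coeff b i.

Lemma norm_exp_coeff a i : `|exp_coeff a i| <= exp_coeff `|a| i.
Proof. by rewrite /exp_coeff /= normrM normrX normfV normr_nat. Qed.

Lemma norm_cos_coeff b i : `|cos_coeff b i| <= exp_coeff `|b| i.
Proof.
rewrite /cos_coeff /exp_coeff /= -exprnP !normrM normfV !normr_nat !normrX.
rewrite normrN normr1 expr1n mulr1.
by case: odd; rewrite ?mul0r ?mul1r // mulr_ge0 ?exprn_ge0 // invr_ge0.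
Qed.

Lemma norm_sin_coeff b i : `|sin_coeff b i| <= exp_coeff `|b| i.
Proof.
rewrite /sin_coeff /exp_coeff /= !normrM normfV !normr_nat !normrX.
rewrite normrN normr1 expr1n mulr1.
by case: odd; rewrite ?mul0r ?mul1r // mulr_ge0 ?exprn_ge0 // invr_ge0.
Qed.

Lemma exp_coeffS a i : i.+1%:R * exp_coeff a i.+1 = a * exp_coeff a i.
Proof.
rewrite /exp_coeff /= exprS factS natrM invfM.
have n0 : i.+1%:R != 0 :> R by rewrite pnatr_eq0.
by move: (i.+1%:R : R) n0 (_ ^-1 : R) => x x0 y; field.
Qed.

Lemma cos_coeffS b i : i.+1%:R * cos_coeff b i.+1 = - (b * sin_coeff b i).
Proof.
have := exp_coeffS b i; rewrite /cos_coeff /sin_coeff /exp_coeff /= -exprnP => H.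
rewrite -[X in _ * X]mulrA mulrCA H negbK uphalf_half.
case: (boolP (odd i)) => [oi|_]; last by rewrite !mul0r mulr0 oppr0.
have -> : i.-1./2 = i./2 by case: i oi {H} => //= i /negbTE oi; rewrite uphalf_half oi.
by rewrite exprS; ring.
Qed.

Lemma sin_coeffS b i : i.+1%:R * sin_coeff b i.+1 = b * cos_coeff b i.
Proof.
have := exp_coeffS b i; rewrite /cos_coeff /sin_coeff /exp_coeff /= -exprnP => H.
by rewrite -[X in _ * X]mulrA mulrCA H; ring.
Qed.

Lemma real_exp_coeffS a i :
  i.+1%:R * (exp_coeff a i.+1)%:C = a%:C * (exp_coeff a i)%:C.
Proof. by rewrite natr_complex -!rmorphM /= exp_coeffS. Qed.

Lemma polar_coeffS b i :
  i.+1%:R * polar_coeff b i.+1 = (0 +i* b) * polar_coeff b i.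
Proof.
apply/eqP; rewrite natr_complex eq_complex /= !mul0r subr0 sub0r addr0 add0r.
by rewrite cos_coeffS sin_coeffS !eqxx.
Qed.

Section RatioLimit.
Variable theta : R.
Hypothesis t0 : 0 < theta.
Local Notation d := (rising_coef theta).

(** Convergence of [N m / d m] to [z], stated by components so that the real limit results apply. *)
Definition ratio_cvg (N : nat -> R[i]) z :=
  (Re (N m) / d m @[m --> \oo] --> Re z) /\
  (Im (N m) / d m @[m --> \oo] --> Im z).

Lemma ratio_cvg_step_conv j (u N : nat -> R[i]) r z U : (0 < j)%N -> 0 <= r ->
  (forall i, `|Re (u i)| <= exp_coeff r i) ->
  (forall i, `|Im (u i)| <= exp_coeff r i) ->
  series (Re \o u) @ \oo --> Re U -> series (Im \o u) @ \oo --> Im U ->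
  ratio_cvg N z -> ratio_cvg (step_conv j u N) (U * z).
Proof.
move=> j0 r0 ru iu rU iU [rz iz].
have cv := step_conv_cvg theta t0 j.
split.
  have -> : (fun m => Re (step_conv j u N m) / d m) = (fun m =>
      step_conv j (Re \o u) (Re \o N) m / d m
      - step_conv j (Im \o u) (Im \o N) m / d m).
    by apply/funext => m; rewrite Re_step_conv mulrBl.
  by rewrite ReM; apply: cvgB; apply: (cv _ _ r).
have -> : (fun m => Im (step_conv j u N m) / d m) = (fun m =>
    step_conv j (Re \o u) (Im \o N) m / d m
    + step_conv j (Im \o u) (Re \o N) m / d m).
  by apply/funext => m; rewrite Im_step_conv mulrDl.
by rewrite ImM; apply: cvgD; apply: (cv _ _ r).
Qed.

Lemma ratio_cvg_exp j a N z : (0 < j)%N -> ratio_cvg N z ->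
  ratio_cvg (step_conv j (fun i => (exp_coeff a i)%:C) N) ((expR a)%:C * z).
Proof.
move=> j0; apply: (@ratio_cvg_step_conv _ _ _ `|a|) => //.
- exact: norm_exp_coeff.
- by move=> i; rewrite normr0 exp_coeff_ge0.
- exact: is_cvg_series_exp_coeff.
have -> : series (Im \o (fun i => (exp_coeff a i)%:C)) = cst 0.
  by apply/funext => n; rewrite /series /= big1.
exact: cvg_cst.
Qed.

Lemma ratio_cvg_polar j b N z : (0 < j)%N -> ratio_cvg N z ->
  ratio_cvg (step_conv j (polar_coeff b) N) ((cos b +i* sin b) * z).
Proof.
move=> j0; apply: (@ratio_cvg_step_conv _ _ _ `|b|) => //.
- exact: norm_cos_coeff.
- exact: norm_sin_coeff.
- by rewrite /= unlock; exact: is_cvg_series_cos_coeff.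
- by rewrite /= unlock; exact: is_cvg_series_sin_coeff.
Qed.

(* Multiplies the generating function by [exp(c X^k)] for one [k] at a time, with
   the real and imaginary parts of [c] treated separately. *)
Lemma exists_exp_rec_cvg n (f : nat -> R[i]) : (forall k, (n < k)%N -> f k = 1) ->
  exists N, [/\ N 0%N = 1, exp_rec _ (fun k => theta%:C * f k) N &
    ratio_cvg N (cexp (theta%:C * \sum_(1 <= k < n.+1) (f k - 1) / k%:R))].
Proof.
elim: n f => [|n IH] f fn.
  (* With all weights equal to [theta] the series is [(1 - X)^-theta] and every ratio is 1. *)
  exists (fun m => (d m)%:C); split; first by rewrite rising_coef0.
    move=> m; rewrite natr_complex -rmorphM /= exp_rec_rising_coef rmorph_sum.
    by apply: eq_bigr => k _; rewrite fn // mulr1 rmorphM.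
  rewrite big_geq // mulr0 cexp0; split => /=.
    have -> : (fun m => d m / d m) = cst 1.
      by apply/funext => m; rewrite mulfV // gt_eqF // rising_coef_gt0.
    exact: cvg_cst.
  have -> : (fun m => 0 / d m) = cst 0 by apply/funext => m; rewrite mul0r.
  exact: cvg_cst.
(* Resetting the value at [n.+1] to 1 makes the induction hypothesis applicable. *)
pose g k := if k == n.+1 then 1 else f k.
have [k nk|N [N0 NR Nz]] := IH g.
  rewrite /g; case: eqP => // /eqP kn; apply: fn.
  by rewrite ltn_neqAle eq_sym kn.
(* Chosen so that [n.+1 * c] is the change of the weight at [n.+1] from [theta] to
   [theta * f n.+1]. *)
pose c : R[i] := theta%:C * ((f n.+1 - 1) / n.+1%:R).
have cE : n.+1%:R * c = theta%:C * (f n.+1 - 1).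
  by rewrite /c mulrCA [n.+1%:R * _]mulrC divfK // natr_complex
    (fmorph_eq0 (real_complex R)) pnatr_eq0.
have cRI : c = (Re c)%:C + (0 +i* Im c).
  by apply/eqP; rewrite eq_complex /= addr0 add0r !eqxx.
exists (step_conv n.+1 (polar_coeff (Im c))
  (step_conv n.+1 (fun i => (exp_coeff (Re c) i)%:C) N)); split.
- rewrite !step_conv0 N0 /polar_coeff /cos_coeff /sin_coeff /exp_coeff /=.
  by rewrite !expr0 fact0 !divr1 !mulr1.
- have := exp_rec_step_conv _ _ _ _ _ (ltn0Sn n) (polar_coeffS (Im c))
    (exp_rec_step_conv _ _ _ _ _ (ltn0Sn n) (real_exp_coeffS (Re c)) NR).
  move=> H m; rewrite (H m); apply: eq_bigr => k _; congr (_ * _).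
  rewrite /g; case: eqP => [->|_]; last by rewrite !mulr0n !addr0.
  by rewrite !mulr1n -addrA -mulrDr -cRI cE; ring.
have -> : cexp (theta%:C * \sum_(1 <= k < n.+2) (f k - 1) / k%:R) =
   (cos (Im c) +i* sin (Im c)) * ((expR (Re c))%:C *
     cexp (theta%:C * \sum_(1 <= k < n.+1) (g k - 1) / k%:R)).
  rewrite big_nat_recr //= mulrDr -/c addrC cexpD.
  rewrite (eq_big_nat _ _ (F2 := fun k => (g k - 1) / k%:R)); last first.
    by move=> k /andP[_ kn]; rewrite /g ltn_eqF.
  by rewrite {1}/cexp mulrA; congr (_ * _); rewrite mulrC.
by apply: ratio_cvg_polar => //; exact: ratio_cvg_exp.
Qed.

(** A bound valid for all large [m] survives the limit; the halves of [e] go to the real and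
    imaginary parts. *)
Lemma ratio_cvg_bound n (N : nat -> R[i]) x z (B : R) : ratio_cvg N z ->
  (forall m, (n <= m)%N -> cmod (x - N m / (d m)%:C) <= B) -> cmod (x - z) <= B.
Proof.
move=> [rz iz] xB; apply/ler_addgt0Pr => e e0.
have e2 : 0 < e / 2 by rewrite divr_gt0.
have /cvgrPdist_le/(_ _ e2) nr := rz.
have /cvgrPdist_le/(_ _ e2) ni := iz.
near \oo => m.
have nm : (n <= m)%N by near: m; exists n.
have Hr : `|Re z - Re (N m) / d m| <= e / 2 by near: m.
have Hi : `|Im z - Im (N m) / d m| <= e / 2 by near: m.
rewrite (_ : x - z = (x - N m / (d m)%:C) + (N m / (d m)%:C - z)); last by ring.
apply: (le_trans (ler_cmodD _ _)); apply: lerD; first exact: xB.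
have NE : N m / (d m)%:C = (Re (N m) / d m) +i* (Im (N m) / d m).
  rewrite -(fmorphV (real_complex R)); case: (N m) => p q.
  by apply/eqP; rewrite eq_complex /= !mulr0 subr0 add0r !eqxx.
rewrite cmodB; apply: (le_trans (ler_cmod_ReIm _)).
rewrite NE; case: (z) Hr Hi => p q /= Hr Hi.
by apply: (le_trans (lerD Hr Hi)); rewrite -splitr.
Unshelve. all: by end_near. Qed.

End RatioLimit.
End ComplexLimit.

(** * The uniform bound for the Ewens mean *)

Theorem theorem1p3 (R : realType) (theta p : R)
    (htheta : 0 < theta) (hp : Num.max 1 (1 / theta) < p) :
  exists C : R, 0 < C /\
    forall (n : nat) (fhat : nat -> R[i]),
      (1 <= n)%N ->
      (forall j : nat, (1 <= j <= n)%N -> cmod (fhat j) <= 1) ->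
      cmod (mean_value theta (mulfun (n := n) fhat)
            - cexp (theta%:C * \sum_(1 <= k < n.+1) (fhat k - 1) / k%:R))
      <= C * mu n p fhat.
Proof.
have [p1 pt] : 1 < p /\ 1 < p * theta.
  by move: hp; rewrite gt_max ltr_pdivrMr // => /andP[].
have p0 : 0 < p by exact: lt_trans p1.
pose q := p / (p - 1).
pose C := 2 * theta * (1 - q * (1 - theta))^-1 `^ q^-1 * (1 + theta * p).
exists C; split.
  have c0 : 0 < 1 - q * (1 - theta).
    have -> : 1 - q * (1 - theta) = (p * theta - 1) / (p - 1).
      by rewrite /q; field; rewrite subr_eq0 gt_eqF.
    by apply: divr_gt0; rewrite subr_gt0.
  by rewrite !mulr_gt0 ?powR_gt0 ?invr_gt0 // addr_gt0 // mulr_gt0.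
move=> n fhat n0 fhat1.
(* The extension by 1 changes neither the mean at [n] nor the exponent, and gives meaning to the
   means at all [m >= n]. *)
pose f k := if (1 <= k <= n)%N then fhat k else 1.
have fE k : (1 <= k < n.+1)%N -> fhat k = f k by rewrite /f ltnS => ->.
have f1 k : cmod (f k) <= 1.
  rewrite /f; case: ifP => [|_]; first exact: fhat1.
  by rewrite /cmod ComplexField.Normc.normc1.
have fn k : (n < k)%N -> f k = 1.
  by move=> nk; rewrite /f [(k <= n)%N]leqNgt nk andbF.
have [N [N0 NR Nz]] := exists_exp_rec_cvg theta htheta n f fn.
have -> : mulfun (n := n) fhat = mulfun (n := n) f.
  by apply/funext => s; apply: eq_big_nat => k kn; rewrite fE.
have -> : \sum_(1 <= k < n.+1) (fhat k - 1) / k%:R =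
    \sum_(1 <= k < n.+1) (f k - 1) / k%:R.
  by apply: eq_big_nat => k kn; rewrite fE.
rewrite (mean_value_exp_rec theta n f N htheta N0 NR).
(* The sequence [N] does not depend on [m], so the variation bound passes to the limit. *)
apply: (ratio_cvg_bound theta n N _ _ _ Nz) => m nm.
apply: (le_trans (mean_variation theta f N htheta f1 N0 NR p q n m p1 pt erefl n0 nm fn)).
(* The bounds agree exactly: [n^(-1/p)] is the normalization inside [mu]. *)
rewrite le_eqVlt; apply/predU1P; left; congr (_ * _).
rewrite /mu big_add1 /= big_mkord.
rewrite powRM ?invr_ge0 //; last by rewrite sumr_ge0 // => k _; exact: powR_ge0.
have -> : (n%:R^-1 : R) `^ p^-1 = n%:R `^ (- p^-1).
  by rewrite -powR_inv1 // -powRrM mulN1r.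
rewrite mulrC; congr (_ * (_ `^ _)).
by apply: eq_bigr => k _; rewrite fE //= ltnS ltn_ord.
Qed.
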